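(* Let $\lambda\in\mathbb{R}$. For every integer $n\ge 0$ and real $u>0$, let $$g_{n,\lambda}(u)=u^{n\lambda}\left(u^{1-\lambda}\frac{d}{du}\right)^{n}\left(\frac{u}{1+u^{2}}\right).$$ Then $$g_{n,\lambda}(u)=\sum_{k=0}^{n}a(n,k\vert\lambda)\,u^{2k+1}(u^{2}+1)^{-k-1},$$ with $$a(n,k\vert\lambda)=\sum_{j=0}^{k}(-1)^{j}\binom{k}{j}(2j+1)_{n,\lambda}.$$
   Context: For $\lambda\in\mathbb{R}$, the degenerate falling factorials are $(x)_{0,\lambda}=1$ and $(x)_{n,\lambda}=x(x-\lambda)(x-2\lambda)\cdots(x-(n-1)\lambda)$ for $n\ge 1$. The operator $\left(u^{1-\lambda}\frac{d}{du}\right)^n$ is the $n$-fold composition of the operator $h\mapsto u^{1-\lambda}\,\frac{dh}{du}$. *)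

(* Defs.v *)
From HB Require Import structures.
From mathcomp Require Import all_boot all_order all_algebra.
From mathcomp Require Import all_classical all_reals all_analysis.
Set Implicit Arguments.
Unset Strict Implicit.
Unset Printing Implicit Defensive.
Import Order.TTheory GRing.Theory Num.Theory.
Import numFieldNormedType.Exports.
Local Open Scope ring_scope.

Definition degenerate_falling (R : realType) (lambda x : R) (n : nat) : R :=
  \prod_(i < n) (x - i%:R * lambda).

(* Both [powR] and [derive1] are total, with junk values for u <= 0 resp. where
   h is not derivable; derivatives at u > 0 only see h near u, so iterating on
   functions R -> R is the operator u^(1-lambda) d/du on the open half-line. *)
Definition degenerate_derivation (R : realType) (lambda : R) (h : R -> R) : R -> R :=
  fun u => u `^ (1 - lambda) * derive1 h u.

Definition gfun (R : realType) (lambda : R) (n : nat) (u : R) : R :=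
  u `^ (n%:R * lambda) *
    iter n (degenerate_derivation lambda) (fun v : R => v / (1 + v ^+ 2)) u.

Definition acoef (R : realType) (lambda : R) (n k : nat) : R :=
  \sum_(j < k.+1) (-1) ^+ j * 'C(k, j)%:R * degenerate_falling lambda (2 * j + 1)%:R n.

(* Main.v *)
Require Import Defs.
From HB Require Import structures.
From mathcomp Require Import all_boot all_order all_algebra.
From mathcomp Require Import all_classical all_reals all_analysis.
From mathcomp Require Import ring.
Set Implicit Arguments.
Unset Strict Implicit.
Unset Printing Implicit Defensive.
Import Order.TTheory GRing.Theory Num.Theory.
Import numFieldNormedType.Exports.
Local Open Scope ring_scope.

(** Put [F_k(u) = u^(2k+1) (u^2+1)^(-k-1)], so that [F_0] is the function being
    differentiated.  The Euler operator acts on these functions by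
    [u F_k' = (2k+1) F_k - 2(k+1) F_(k+1)] ([is_derive_rational_basis]).  Hence,
    if the [n]-th iterate is [u^(-n lambda) \sum_k a_k F_k] on the half-line
    [u > 0], the next one is [u^(-(n+1) lambda) \sum_k a'_k F_k], where
    [a'_k = (2k+1 - n lambda) a_k - 2k a_(k-1)].

    The alternating sums [acoef] satisfy the same recurrence
    ([acoef_recurrence]): the factor [2j+1 - n lambda] by which the falling
    factorial of [2j+1] grows is [(2k+1 - n lambda) - 2(k-j)], and
    [(k-j) 'C(k,j) = k 'C(k-1,j)].  Both sequences start from the indicator of
    [k = 0], so they agree. *)

Definition rational_basis (R : realType) (k : nat) (u : R) : R :=
  u ^+ (2 * k + 1) * (u ^+ 2 + 1) ^- (k + 1).

Lemma acoefS0 (R : realType) (lambda : R) (n : nat) :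
  acoef lambda n.+1 0 = (1 - n%:R * lambda) * acoef lambda n 0.
Proof.
rewrite /acoef !big_ord1 /degenerate_falling big_ord_recr /= muln0 add0n.
ring.
Qed.

(** Absorbing a factor [k.+1 - j] into ['C(k.+1, j)] lowers the upper index of the
    binomial coefficient; this produces the term in [acoef lambda n k]. *)
Lemma acoef_recurrence (R : realType) (lambda : R) (n k : nat) :
  acoef lambda n.+1 k.+1 =
  ((2 * k.+1 + 1)%:R - n%:R * lambda) * acoef lambda n k.+1
  - (2 * k.+1)%:R * acoef lambda n k.
Proof.
(* The null term at j = k+1 gives all three sums the same range. *)
have -> : acoef lambda n k = \sum_(j < k.+2) (-1) ^+ j * 'C(k, j)%:R *
    degenerate_falling lambda (2 * j + 1)%:R n.
  by rewrite big_ord_recr /= bin_small // mulr0 mul0r addr0.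
rewrite /acoef !mulr_sumr -sumrB; apply: eq_bigr => j _.
have Hb : k.+1%:R * 'C(k, j)%:R = (k.+1%:R - j%:R) * 'C(k.+1, j)%:R :> R.
  by rewrite -natrB; [rewrite -!natrM -mul_bin_down | rewrite -ltnS].
rewrite {1}/degenerate_falling big_ord_recr /= -/(degenerate_falling _ _ _).
set P := degenerate_falling _ _ _; set s := (-1) ^+ j.
have -> : (2 * k.+1)%:R * (s * 'C(k, j)%:R * P) =
    2 * s * P * (k.+1%:R * 'C(k, j)%:R) by rewrite natrM; ring.
rewrite Hb !natrD !natrM; ring.
Qed.

Lemma acoef0 (R : realType) (lambda : R) : acoef lambda 0 0 = 1.
Proof.
by rewrite /acoef big_ord1 /degenerate_falling big_ord0 expr0 bin0 !mulr1.
Qed.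

(** For [n = 0] this is the vanishing of an alternating row of Pascal's
    triangle; the recurrence then moves the vanishing range up by one at each
    step. *)
Lemma acoef_eq0 (R : realType) (lambda : R) (n k : nat) :
  (n < k)%N -> acoef lambda n k = 0.
Proof.
elim: n k => [|n IHn] [|k] // lt_nk; last first.
  by rewrite acoef_recurrence !IHn ?mulr0 ?subr0 // ltnW.
rewrite /acoef; transitivity ((1 - 1 : R) ^+ k.+1); last by rewrite subrr expr0n.
rewrite exprBn; apply: eq_bigr => j _.
by rewrite /degenerate_falling big_ord0 !expr1n !mulr1 mulr_natr.
Qed.

Lemma is_derive_rational_basis (R : realType) (k : nat) (u : R) : 0 < u ->
  is_derive u 1 (@rational_basis R k)
    (u^-1 * ((2 * k + 1)%:R * rational_basis k u
             - (2 * k.+1)%:R * rational_basis k.+1 u)).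
Proof.
move=> u0.
have u2_neq0 : u ^+ 2 + 1 != 0 by rewrite gt_eqF // ltr_wpDl // sqr_ge0.
have dnum := is_deriveX (2 * k + 1) (is_derive_id u (1 : R)).
have dbase : is_derive u 1 ((@id R) ^+ 2 + cst 1) (2 * u).
  by apply: is_derive_eq; rewrite expr1 addr0 /GRing.scale /= mulr1.
have dden := is_deriveX (k + 1) dbase.
have den_neq0 : (((@id R) ^+ 2 + cst 1) ^+ (k + 1)) u != 0.
  by rewrite !fctE expf_neq0.
have := is_deriveM dnum (is_deriveV den_neq0 dden).
set f := (X in is_derive _ _ X _).
have -> : f = @rational_basis R k.
  by apply/funext => v; rewrite /rational_basis /f !fctE.
move=> H; apply: is_derive_eq.
rewrite /rational_basis !fctE /= /GRing.scale /= !addn1 /= mulnS.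
have dk_neq0 : (u ^+ 2 + 1) ^+ k != 0 by rewrite expf_neq0.
have u_neq0 : u != 0 by rewrite gt_eqF.
move: u2_neq0 dk_neq0; rewrite add2n !(exprS _ (2 * k).+2) !(exprS _ (2 * k).+1).
rewrite !(exprS _ (2 * k)) !(exprS _ k.+1) !(exprS _ k).
have -> : (2 * k).+2%:R = 2 * k.+1%:R :> R by rewrite -natrM mulnS.
(* The identity holds with u^2+1 replaced by any nonzero d. *)
move: (u ^+ 2 + 1) => d; move: (d ^+ k) (u ^+ (2 * k)) => e w d0 e0.
field.
by rewrite d0 e0 u_neq0.
Qed.

(** As [v `^ c] is an eigenvector of the Euler operator for the eigenvalue [c],
    multiplying by it shifts the diagonal coefficient of that operator by [c];
    this is how the prefactor of the iterates enters the recurrence. *)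
Lemma is_derive_powR_rational_basis (R : realType) (c : R) (k : nat) (u : R) :
  0 < u ->
  is_derive u 1 (fun v => v `^ c * rational_basis k v)
    (u `^ (c - 1) * (((2 * k + 1)%:R + c) * rational_basis k u
                     - (2 * k.+1)%:R * rational_basis k.+1 u)).
Proof.
move=> u0.
have dM := is_deriveM (is_derive1_powR c u0) (is_derive_rational_basis k u0).
apply: is_derive_eq.
have -> : u `^ (c - 1) = u `^ c * u^-1.
  by rewrite powRD ?powR_inv1 ?ltW // (gt_eqF u0) implybT.
rewrite /GRing.scale /=; ring.
Qed.

(** The form in which [acoef_recurrence] meets the derivative of an iterate, with
    [F k] for the rational functions.  It also needs [acoef lambda n n.+1 = 0],
    as the recurrence for the top index [n.+1] involves that coefficient while
    the sum over [k <= n] does not. *)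
Lemma acoef_sum_recurrence (R : realType) (lambda : R) (n : nat) (F : nat -> R) :
  \sum_(k < n.+1) acoef lambda n k *
     (((2 * k + 1)%:R - n%:R * lambda) * F k - (2 * k.+1)%:R * F k.+1) =
  \sum_(k < n.+2) acoef lambda n.+1 k * F k.
Proof.
rewrite [RHS]big_ord_recl /= acoefS0.
under [X in _ = _ + X]eq_bigr => k _.
  rewrite /bump add1n acoef_recurrence mulrBl; over.
rewrite sumrB addrA.
have -> : (1 - n%:R * lambda) * acoef lambda n 0 * F 0 +
    \sum_(i < n.+1) ((2 * i.+1 + 1)%:R - n%:R * lambda) *
      acoef lambda n i.+1 * F i.+1 =
    \sum_(i < n.+2) ((2 * i + 1)%:R - n%:R * lambda) * acoef lambda n i * F i.
  by rewrite [RHS]big_ord_recl.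
rewrite [X in _ = X - _]big_ord_recr /= acoef_eq0 // mulr0 mul0r addr0 -sumrB.
apply: eq_bigr => k _; ring.
Qed.

Lemma iter_degenerate_derivation (R : realType) (lambda : R) (n : nat) (u : R) :
  0 < u ->
  iter n (degenerate_derivation lambda) (fun v : R => v / (1 + v ^+ 2)) u =
  \sum_(k < n.+1) acoef lambda n k *
    (u `^ (- (n%:R * lambda)) * rational_basis k u).
Proof.
elim: n u => [|n IHn] u u0.
  rewrite big_ord1 acoef0 mul0r oppr0 powRr0 !mul1r /rational_basis.
  by rewrite muln0 !add0n !expr1 addrC.
rewrite iterS /degenerate_derivation -/(degenerate_derivation lambda) derive1E.
set c := - (n%:R * lambda).
set S := \sum_(k < n.+1) acoef lambda n k \*: (fun v => v `^ c * rational_basis k v).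
(* A derivative at u > 0 depends only on the values near u, which are positive. *)
have -> : 'D_1 (iter n (degenerate_derivation lambda)
    (fun v : R => v / (1 + v ^+ 2))) u = 'D_1 S u.
  apply: near_eq_derive; near=> v.
  have v0 : 0 < v by near: v; exact: lt_nbhsr.
  by rewrite IHn // /S fct_sumE.
have dS := is_derive_sum (fun k : 'I_n.+1 =>
  is_deriveZ (acoef lambda n k) (is_derive_powR_rational_basis c k u0)).
have -> := @derive_val _ _ _ _ _ _ _ dS.
have -> : - (n.+1%:R * lambda) = (1 - lambda) + (c - 1).
  by rewrite /c -natr1; ring.
under [RHS]eq_bigr do rewrite mulrCA.
rewrite -mulr_sumr -(acoef_sum_recurrence _ _ (fun k => rational_basis k u)).
rewrite [u `^ (_ + (c - 1))]powRD ?(gt_eqF u0) ?implybT // -mulrA !mulr_sumr.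
by apply: eq_bigr => k _; rewrite /GRing.scale /= mulrCA /c addrC; ring.
Unshelve. all: by end_near. Qed.

Theorem theorem2p9 (R : realType) (lambda : R) (n : nat) (u : R) (hu : 0 < u) :
  gfun lambda n u =
  \sum_(k < n.+1) acoef lambda n k * u ^+ (2 * k + 1) * (u ^+ 2 + 1) ^- (k + 1).
Proof.
rewrite /gfun iter_degenerate_derivation // mulr_sumr.
apply: eq_bigr => k _.
rewrite mulrCA -[RHS]mulrA; congr (_ * _).
by rewrite mulrA -powRD ?(gt_eqF hu) ?implybT // subrr powRr0 mul1r.
Qed.
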